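(* Let $r\ge2$, $n\ge1$ and $0\le k\le n$ be integers. Then $$\mathcal{M}_{n,k}=\left\{x_1^{a_1}\cdots x_n^{a_n}:\ (a_1,\dots,a_n)\text{ is componentwise}\le\text{some shuffle of }(r-1,2r-1,\dots,kr-1)\text{ and }(kr,\dots,kr)\right\},$$ where there are $n-k$ copies of $kr$. Moreover, $$\mathcal{N}_{n,k}=\left\{x_1^{a_1}\cdots x_n^{a_n}:\ (a_1,\dots,a_n)\text{ is componentwise}\le\text{some shuffle of }(r-1,2r-1,\dots,kr-1)\text{ and }(kr-1,\dots,kr-1)\right\},$$ where there are $n-k$ copies of $kr-1$.
   Context: Exponents $a_i$ are nonnegative integers. For $S=\{s_1<s_2<\cdots<s_m\}\subseteq[n]=\{1,\dots,n\}$ the skip monomial is $\mathbf{x}(S)=x_{s_1}^{s_1}x_{s_2}^{s_2-1}\cdots x_{s_m}^{s_m-m+1}$. A monomial $m$ in $x_1,\dots,x_n$ is $(n,k)$-nonskip if $x_i^{kr+1}\nmid m$ for all $1\le i\le n$ and $\mathbf{x}(S)^r\nmid m$ for all $S\subseteq[n]$ with $|S|=n-k+1$. $\mathcal{M}_{n,k}$ is the set of all $(n,k)$-nonskip monomials. A monomial $m\in\mathcal{M}_{n,k}$ is strongly $(n,k)$-nonskip if moreover $x_i^{kr}\nmid m$ for all $1\le i\le n$; $\mathcal{N}_{n,k}$ is the set of strongly $(n,k)$-nonskip monomials. A shuffle of sequences $(a_1,\dots,a_p)$ and $(b_1,\dots,b_q)$ is an interleaving $(c_1,\dots,c_{p+q})$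 of them which preserves the relative order of the $a$'s and of the $b$'s. *)

(* Defs.v *)
From HB Require Import structures.
From mathcomp Require Import all_boot all_order all_algebra.
From mathcomp Require Export mpoly.
Set Implicit Arguments.
Unset Strict Implicit.
Unset Printing Implicit Defensive.
Import Order.TTheory GRing.Theory Num.Theory.

(* A monomial in x_1, ..., x_n is its exponent vector m : 'X_{1..n}, written
   additively: the variable x_{i+1} is U_(i), its d-th power U_(i) *+ d, and
   m1 divides m2 when (m1 <= m2)%MM. *)

(* The element s = i + 1 of S is s_j with j = index i (enum S) + 1, since
   enum S is increasing, so its exponent s_j - j + 1 is i + 1 - index i (enum S);
   the truncated subtraction is exact because index i (enum S) <= i. *)
Definition skip_monomial (n : nat) (S : {set 'I_n}) : 'X_{1..n} :=
  [multinom (if i \in S then i.+1 - index i (enum S) else 0)%N | i < n].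

(* For k <= n, (n - k).+1 is n - k + 1; if k = 0 no S has that size. *)
Definition nonskip (r n k : nat) (m : 'X_{1..n}) : bool :=
  [forall i : 'I_n, ~~ (U_(i) *+ (k * r).+1 <= m)%MM] &&
  [forall S : {set 'I_n}, (#|S| == (n - k).+1) ==>
     ~~ (skip_monomial S *+ r <= m)%MM].

Definition strongly_nonskip (r n k : nat) (m : 'X_{1..n}) : bool :=
  nonskip r k m && [forall i : 'I_n, ~~ (U_(i) *+ (k * r) <= m)%MM].

(* The mask marks the positions of c that come from a. *)
Definition is_shuffle (T : Type) (a b c : seq T) : Prop :=
  exists msk : bitseq,
    [/\ size msk = size c, mask msk c = a & mask (map negb msk) c = b].

Local Open Scope ring_scope.

(* (r - 1, 2r - 1, ..., kr - 1) *)
Definition staircase (r k : nat) : seq int :=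
  [seq (j * r)%N%:Z - 1 | j <- iota 1 k].

(* Shuffle entries are integers: for k = 0 the entry kr - 1 is -1, which bounds
   no exponent, whereas natural-number subtraction would give 0. *)
Definition below_some_shuffle (n : nat) (a b : seq int) (m : 'X_{1..n}) : Prop :=
  exists c : seq int,
    is_shuffle a b c /\ forall i : 'I_n, (m i)%:Z <= c`_i.

(* Main.v *)
Require Import Defs.
From mathcomp Require Import all_boot all_order all_algebra.
From mathcomp Require Import zify.
Set Implicit Arguments.
Unset Strict Implicit.
Unset Printing Implicit Defensive.
Import Order.TTheory.
Local Open Scope ring_scope.

(** The exponent of x_i in the skip monomial of S is one more than the number
    of earlier indices outside S, so x(S)^r divides the monomial with exponents
    a_i exactly when every i in S has
      r * (1 + number of earlier indices outside S) <= a_i.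
    Dually, if T is the set of positions that a shuffle gives to the staircase,
    lying below the shuffle means that every i in T has
      a_i < r * (1 + number of earlier indices in T),
    together with a uniform bound on all the exponents.  So the complement of S
    and the set T play opposite roles, and the two constraints are compared by
    one invariant ([rank_le_rankC]): at every prefix, T contains at most as many
    indices as the complement of S.  As T has k elements and the complement of a
    skip set of size n - k + 1 has only k - 1, a monomial below a shuffle is
    divisible by no such x(S)^r.

    For the converse, scan the indices from left to right and take i into T
    whenever the staircase inequality holds at that moment ([greedy]).  Then T
    satisfies the staircase condition, and every index left out satisfies the
    skip inequality, so the complement of T is a skip set ([greedy_skips]).
    Both conditions at i look only at smaller indices, hence survive cutting a
    set down to its first few elements ([rank_cap]).  If T has fewer than k
    elements, the first n - k + 1 elements of its complement form a forbidden
    skip set; otherwise the first k elements of T are the staircase positions of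
    a shuffle.

    Both equalities of the theorem are instances of this argument
    ([below_shuffleP]), with kr and kr - 1 as the uniform bound. *)

(** * Counting the elements of a set of indices below a given index *)

(** Index sets are encoded as predicates on [nat], which makes the induction on
    prefixes immediate. *)
Definition rank (p : pred nat) (i : nat) : nat := count p (iota 0 i).

Lemma rank0 (p : pred nat) : rank p 0 = 0%N.
Proof. by []. Qed.

Lemma rankS (p : pred nat) i : rank p i.+1 = (rank p i + p i)%N.
Proof. by rewrite /rank -addn1 iotaD count_cat /= addn0. Qed.

Lemma rankC (p : pred nat) i : (rank p i + rank (predC p) i)%N = i.
Proof. by rewrite /rank count_predC size_iota. Qed.

Lemma eq_in_rank (p q : pred nat) n :
  (forall j, (j < n)%N -> p j = q j) -> rank p n = rank q n.
Proof. by move=> pq; apply: eq_in_count => j; rewrite mem_iota; apply: pq. Qed.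

Lemma rank_ltn (p : pred nat) i n :
  p i -> (i < n)%N -> (rank p i < rank p n)%N.
Proof.
move=> pi; elim: n => // n IHn; rewrite ltnS leq_eqVlt rankS.
by case/predU1P=> [<-|/IHn]; rewrite ?pi; lia.
Qed.

Definition cap (N : nat) (p : pred nat) : pred nat :=
  fun i => p i && (rank p i < N)%N.

Lemma rank_cap N p i : rank (cap N p) i = minn N (rank p i).
Proof.
elim: i => [|i IHi]; first by rewrite !rank0 minn0.
by rewrite !rankS IHi /cap; case: (p i) => /=; case: ltnP; lia.
Qed.

Lemma rank_cap_mem N p i : cap N p i -> rank (cap N p) i = rank p i.
Proof. by rewrite rank_cap => /andP[_ lt_pi]; apply/minn_idPr/ltnW. Qed.

Lemma index_filter_rank (p : pred nat) i n :
  p i -> (i < n)%N -> index i (filter p (iota 0 n)) = rank p i.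
Proof.
move=> pi lt_in; rewrite -(subnKC lt_in) -addn1 -addnA iotaD.
rewrite filter_cat index_cat mem_filter mem_iota ltnn andbF.
by rewrite /= pi /= eqxx addn0 size_filter.
Qed.

Lemma index_enum_rank n (S : {set 'I_n}) (p : pred nat) (i : 'I_n) :
  (forall j : 'I_n, (j \in S) = p j) -> i \in S ->
  index i (enum S) = rank p i.
Proof.
move=> Sp; rewrite Sp => pi.
have valS : map val (enum S) = filter p (iota 0 n).
  rewrite -val_enum_ord filter_map; congr map.
  by rewrite enumT; apply: eq_filter => j; rewrite /= -Sp.
by rewrite -(index_map val_inj) valS (index_filter_rank pi (ltn_ord i)).
Qed.

Lemma card_rank n (S : {set 'I_n}) (p : pred nat) :
  (forall j : 'I_n, (j \in S) = p j) -> #|S| = rank p n.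
Proof.
move=> Sp; rewrite cardE size_filter /rank -val_enum_ord count_map enumT.
by apply: eq_count => j; rewrite /= -Sp.
Qed.

(** * Skip sets against staircase sets *)

Definition skips (r n : nat) (a : nat -> nat) (s : pred nat) : Prop :=
  forall i, (i < n)%N -> s i -> (r * (rank (predC s) i).+1 <= a i)%N.

Definition under_stairs (r n : nat) (a : nat -> nat) (t : pred nat) : Prop :=
  forall i, (i < n)%N -> t i -> (a i < r * (rank t i).+1)%N.

(** When the two counts agree before [i], membership of [i] in both [t] and [s]
    would ask for [a i] to be both below and at least the same number, so the
    count of the complement of [s] can never be overtaken. *)
Lemma rank_le_rankC r n a s t :
  skips r n a s -> under_stairs r n a t -> (rank t n <= rank (predC s) n)%N.
Proof.
elim: n => // n IHn skip_s stairs_t; rewrite !rankS /=.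
have le_ts : (rank t n <= rank (predC s) n)%N.
  by apply: IHn => i lt_in; [apply: skip_s | apply: stairs_t]; apply: ltnW.
have := skip_s n (ltnSn n); have := stairs_t n (ltnSn n).
case: (t n) (s n) => [] [] //=; try lia.
move=> /(_ isT) lt_a /(_ isT) le_a.
have := leq_ltn_trans le_a lt_a; rewrite ltn_mul2l => /andP[_].
by lia.
Qed.

(** The scan decides on [i] from its own count so far, so that count needs a
    recursion of its own; [rank_greedy] identifies it with the rank. *)
Fixpoint greedy_rank (r : nat) (a : nat -> nat) (i : nat) : nat :=
  if i is j.+1
  then (greedy_rank r a j + (a j < r * (greedy_rank r a j).+1)%N)%N
  else 0%N.

Definition greedy (r : nat) (a : nat -> nat) : pred nat :=
  fun i => (a i < r * (greedy_rank r a i).+1)%N.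

Lemma rank_greedy r a i : rank (greedy r a) i = greedy_rank r a i.
Proof. by elim: i => // i IHi; rewrite rankS IHi. Qed.

Lemma greedy_under_stairs r n a : under_stairs r n a (greedy r a).
Proof. by move=> i _; rewrite rank_greedy. Qed.

Lemma greedy_skips r n a : skips r n a (predC (greedy r a)).
Proof.
move=> i _; rewrite (@eq_in_rank _ (greedy r a)) => [|j _]; last exact: negbK.
by rewrite rank_greedy /= /greedy -leqNgt.
Qed.

Lemma cap_under_stairs r n a N t :
  under_stairs r n a t -> under_stairs r n a (cap N t).
Proof.
move=> stairs_t i lt_in ti; rewrite rank_cap_mem //.
by apply: stairs_t => //; case/andP: ti.
Qed.

Lemma cap_skips r n a N s : skips r n a s -> skips r n a (cap N s).
Proof.
move=> skip_s i lt_in si.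
have ->: rank (predC (cap N s)) i = rank (predC s) i.
  by have := rankC (cap N s) i; have := rankC s i; rewrite rank_cap_mem //; lia.
by apply: skip_s => //; case/andP: si.
Qed.

(** The sizes make the two sides exclusive: a staircase set with [k] elements and
    a complement with [k - 1] would contradict [rank_le_rankC]. *)
Lemma no_skipsP r n k a : (k <= n)%N ->
  (forall s, rank s n = (n - k).+1 -> ~ skips r n a s) <->
  (exists t, rank t n = k /\ under_stairs r n a t).
Proof.
move=> le_kn; split=> [no_skip | [t [rank_t stairs_t]] s rank_s skip_s]; last first.
  by have := rank_le_rankC skip_s stairs_t; have := rankC s n; lia.
exists (cap k (greedy r a)); split; last first.
  exact/cap_under_stairs/greedy_under_stairs.
rewrite rank_cap; apply/minn_idPl; rewrite leqNgt; apply/negP=> lt_gk.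
apply: (no_skip (cap (n - k).+1 (predC (greedy r a)))); last first.
  exact/cap_skips/greedy_skips.
by rewrite rank_cap; have := rankC (greedy r a) n; lia.
Qed.

(** * Divisibility by skip monomials *)

Lemma skip_monomialE n (S : {set 'I_n}) (p : pred nat) (i : 'I_n) :
  (forall j : 'I_n, (j \in S) = p j) ->
  skip_monomial S i = if p i then (rank (predC p) i).+1 else 0%N.
Proof.
move=> Sp; rewrite mnmE Sp; case: ifP => // pi.
by rewrite (index_enum_rank Sp) ?Sp //; have := rankC p i; lia.
Qed.

Lemma skip_monomial_dvdP r n (S : {set 'I_n}) (p : pred nat) (m : 'X_{1..n}) :
  (forall j : 'I_n, (j \in S) = p j) ->
  reflect (skips r n (nth 0%N m) p) (skip_monomial S *+ r <= m)%MM.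
Proof.
move=> Sp; apply: (iffP mnm_lepP) => [le_m i lt_in pi | skip_p i].
  have := le_m (Ordinal lt_in).
  by rewrite mulmnE (skip_monomialE _ Sp) /= pi (mnm_nth 0) mulnC.
rewrite mulmnE (skip_monomialE _ Sp) (mnm_nth 0) mulnC.
by case: ifP => [pi|_]; [apply: skip_p | rewrite muln0].
Qed.

Lemma no_skip_monomialP r n k (m : 'X_{1..n}) :
  [forall S : {set 'I_n}, (#|S| == (n - k).+1) ==>
     ~~ (skip_monomial S *+ r <= m)%MM] <->
  (forall s, rank s n = (n - k).+1 -> ~ skips r n (nth 0%N m) s).
Proof.
split=> [/forallP no_dvd s rank_s | no_skip].
  pose S := [set i : 'I_n | s i].
  have Ss (j : 'I_n) : (j \in S) = s j by rewrite inE.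
  have := no_dvd S; rewrite (card_rank Ss) rank_s eqxx.
  by move/(skip_monomial_dvdP r m Ss).
apply/forallP=> S; apply/implyP=> /eqP card_S.
pose s : pred nat := fun j => j \in map val (enum S).
have Ss (j : 'I_n) : (j \in S) = s j.
  by rewrite /s mem_map ?mem_enum //; apply: val_inj.
apply/(skip_monomial_dvdP r m Ss); apply: no_skip.
by rewrite -(card_rank Ss).
Qed.

Lemma varX_dvd n (i : 'I_n) d (m : 'X_{1..n}) :
  (U_(i) *+ d <= m)%MM = (d <= m i)%N.
Proof.
apply/mnm_lepP/idP => [/(_ i)|le_d j]; first by rewrite mulmnE mnm1E eqxx mul1n.
by rewrite mulmnE mnm1E; case: eqP => [<-|_]; rewrite ?mul1n ?mul0n.
Qed.

(** * Shuffles *)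

Lemma rank_nth_cons b (w : bitseq) i :
  rank (nth false (b :: w)) i.+1 = (b + rank (nth false w) i)%N.
Proof. by rewrite /rank /= (iotaDl 1 0) count_map. Qed.

Lemma rank_nth (w : bitseq) : rank (nth false w) (size w) = count id w.
Proof. by elim: w => // b w IHw; rewrite rank_nth_cons IHw. Qed.

Lemma nth_mask_rank (T : Type) (x0 : T) w (c : seq T) i :
  nth false w i -> nth x0 (mask w c) (rank (nth false w) i) = nth x0 c i.
Proof.
elim: w c i => [|b w IHw] [|x c] [|i] //=; rewrite ?nth_nil //.
  by move->.
by rewrite rank_nth_cons; case: b => /=; apply: IHw.
Qed.

Lemma shuffle_exists (T : Type) (w : bitseq) (a b : seq T) :
  count id w = size a -> count negb w = size b ->
  exists c, [/\ size w = size c, mask w c = a & mask (map negb w) c = b].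
Proof.
elim: w a b => [|[] w IHw] a b /=.
- by case: a b => [|? ?] [|? ?] // _ _; exists [::].
- case: a => // x a; rewrite add1n add0n => -[wa] wb.
  by have [c [sz <- <-]] := IHw a b wa wb; exists (x :: c); rewrite /= sz.
- case: b => // y b; rewrite add1n add0n => wa [wb].
  by have [c [sz <- <-]] := IHw a b wa wb; exists (y :: c); rewrite /= sz.
Qed.

(** A shuffle takes at [i] the next unused entry of one of its two sources, which
    is the entry of index [rank t i] of [a] if [t] marks the positions given to [a]; for
    the constant source the index is immaterial. *)
Lemma shuffle_nseqP (T : Type) (x0 : T) n k (a : seq T) b (P : nat -> T -> Prop) :
  size a = k -> (k <= n)%N ->
  (exists c, is_shuffle a (nseq (n - k) b) c /\
     forall i, (i < n)%N -> P i (nth x0 c i)) <->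
  (exists t, rank t n = k /\
     forall i, (i < n)%N -> P i (if t i then nth x0 a (rank t i) else b)).
Proof.
move=> sz_a le_kn.
have nth_c w c i : mask w c = a -> mask (map negb w) c = nseq (n - k) b ->
    size w = size c -> (i < size w)%N ->
    nth x0 c i = if nth false w i then nth x0 a (rank (nth false w) i) else b.
  move=> Ea Eb sz lt_iw; case: ifP => wi; first by rewrite -Ea nth_mask_rank.
  have nwi : nth false (map negb w) i by rewrite (nth_map false) ?wi.
  rewrite -(nth_mask_rank _ _ nwi) Eb nth_nseq ifT //.
  rewrite -(size_nseq (n - k) b) -Eb size_mask ?size_map // -rank_nth.
  by apply: rank_ltn; rewrite ?size_map.
split=> [[c [[w [sz Ea Eb]] Pc]] | [t [rank_t Pt]]].
  have cnt_w : count id w = k by rewrite -sz_a -Ea size_mask.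
  have sz_w : size w = n.
    have := congr1 size Eb; rewrite size_mask ?size_map // size_nseq count_map.
    have : (count id w + count (preim negb id) w)%N = size w.
      exact: count_predC.
    by rewrite cnt_w; lia.
  exists (nth false w); split; first by rewrite -[n in rank _ n]sz_w rank_nth.
  by move=> i lt_in; rewrite -(nth_c w c i Ea Eb sz) ?sz_w //; apply: Pc.
pose w := mkseq t n.
have w_t i : (i < n)%N -> nth false w i = t i by apply: nth_mkseq.
have cnt_w : count id w = k.
  by rewrite -rank_nth size_mkseq (@eq_in_rank _ t).
have [||c [sz Ea Eb]] := @shuffle_exists T w a (nseq (n - k) b).
- by rewrite cnt_w.
- have : (count id w + count negb w)%N = size w by exact: count_predC.
  by rewrite cnt_w size_mkseq size_nseq; lia.
exists c; split=> [|i lt_in]; first by exists w.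
rewrite (nth_c w c i Ea Eb sz) ?size_mkseq // w_t // (@eq_in_rank _ t); first exact: Pt.
by move=> j lt_ji; apply/w_t/(ltn_trans lt_ji).
Qed.

Lemma nth_staircase r k j :
  (j < k)%N -> (staircase r k)`_j = (r * j.+1)%N%:Z - 1.
Proof.
by move=> lt_jk; rewrite (nth_map 0%N) ?size_iota // nth_iota // add1n mulnC.
Qed.

(** The staircase entries are at most [k * r - 1], so the bound [b] on the
    remaining entries bounds the whole shuffle; conversely it is all that is
    asked of an exponent outside the staircase positions. *)
Lemma below_shuffleP r n k (b : int) (m : 'X_{1..n}) :
  (k <= n)%N -> (k * r)%N%:Z - 1 <= b ->
  below_some_shuffle (staircase r k) (nseq (n - k) b) m <->
  (forall i : 'I_n, (m i)%:Z <= b) /\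
  [forall S : {set 'I_n}, (#|S| == (n - k).+1) ==>
     ~~ (skip_monomial S *+ r <= m)%MM].
Proof.
move=> le_kn le_b.
have sz_st : size (staircase r k) = k by rewrite size_map size_iota.
have below_t : below_some_shuffle (staircase r k) (nseq (n - k) b) m <->
    (exists t, rank t n = k /\ forall i, (i < n)%N ->
       (nth 0%N m i)%:Z <= if t i then (staircase r k)`_(rank t i) else b).
  rewrite -(shuffle_nseqP 0 b (fun i x => (nth 0%N m i)%:Z <= x) sz_st le_kn).
  split=> -[c [sh le_c]]; exists c; split=> // i.
    by move=> lt_in; have := le_c (Ordinal lt_in); rewrite (mnm_nth 0).
  by rewrite (mnm_nth 0); apply: le_c.
rewrite below_t no_skip_monomialP no_skipsP //.
split=> [[t [rank_t le_t]] | [le_m [t [rank_t stairs_t]]]].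
  have stairs_t : under_stairs r n (nth 0%N m) t.
    move=> i lt_in ti; have := le_t i lt_in.
    by rewrite ti nth_staircase; [lia | rewrite -rank_t rank_ltn].
  split; last by exists t.
  move=> i; rewrite (mnm_nth 0); have := le_t i (ltn_ord i).
  case: ifP => // ti _; apply: le_trans le_b.
  have lt_k : (rank t i < k)%N by rewrite -rank_t rank_ltn.
  have := stairs_t i (ltn_ord i) ti.
  have : (r * (rank t i).+1 <= k * r)%N by rewrite mulnC leq_mul2r lt_k orbT.
  by lia.
exists t; split=> // i lt_in; case: ifP => ti; last first.
  by have := le_m (Ordinal lt_in); rewrite (mnm_nth 0).
rewrite nth_staircase; last by rewrite -rank_t rank_ltn.
by have := stairs_t i lt_in ti; lia.
Qed.

Theorem theorem4p13 (r n k : nat) (hr : (2 <= r)%N) (hn : (1 <= n)%N)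
    (hk : (k <= n)%N) :
  (forall m : 'X_{1..n},
     nonskip r k m <->
     below_some_shuffle (staircase r k) (nseq (n - k) ((k * r)%N%:Z)) m) /\
  (forall m : 'X_{1..n},
     strongly_nonskip r k m <->
     below_some_shuffle (staircase r k) (nseq (n - k) ((k * r)%N%:Z - 1)) m).
Proof.
split=> m; rewrite below_shuffleP //; try lia.
  split=> [/andP[/forallP le_m no_dvd] | [le_m no_dvd]].
    by split=> // i; have := le_m i; rewrite varX_dvd; lia.
  by apply/andP; split=> //; apply/forallP=> i; rewrite varX_dvd; have := le_m i; lia.
split=> [/andP[/andP[_ no_dvd] /forallP lt_m] | [lt_m no_dvd]].
  by split=> // i; have := lt_m i; rewrite varX_dvd; lia.
apply/andP; split; last by apply/forallP=> i; rewrite varX_dvd; have := lt_m i; lia.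
by apply/andP; split=> //; apply/forallP=> i; rewrite varX_dvd; have := lt_m i; lia.
Qed.
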